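(* Let $(X,d)$ be a $Q$-ary distance-regular space of dimension $N\ge 2$ over $\mathbb{F}_Q$ with weight $\omega$. Let $k$ be an integer with $0\le k\le N$, and let $\mathcal{F}$ be the family of $\mathbb{F}_Q$-linear codes $\mathcal{C}\le X$ with $\dim(\mathcal{C})=k$. For all $x\in X$ we have $$\overline{\delta_x}(\mathcal{F})=\frac{\omega(x)}{Q^k}+\frac{Q^k-1}{Q^k(Q^N-1)}\left(-\omega(x)+\sum_{i=0}^{|\omega|}i\cdot\boldsymbol{p}(0;i,i)\right).$$
   Context: Let $Q$ be a prime power, $X$ a finite-dimensional $\mathbb{F}_Q$-vector space and $d:X\times X\to\mathbb{N}$ an integer-valued distance function. $(X,d)$ is a $Q$-ary distance-regular space if: (1) $d(\alpha x,\alpha y)=d(x,y)$ for all $x,y\in X$, $\alpha\in\mathbb{F}_Q\setminus\{0\}$; (2) $d(x,y)=d(0,x-y)$ for all $x,y\in X$; (3) for all $x,y\in X$ and $j,k\in\mathbb{N}$, $|\{z\in X\mid d(z,x)=j,\ d(z,y)=k\}|$ depends only on $d(x,y)$ (and $j,k$); (4) with $\omega(x):=d(x,0)$ the weight, $|\omega|:=\max\{\omega(x)\mid x\in X\}=|\omega(X)|-1$, i.e. every integer in $\{0,\dots,|\omega|\}$ is the weight of some vector. The intersection numbers are $\boldsymbol{p}(i;j,k):=|\{z\in X\mid d(z,x)=j,\ d(z,y)=k\}|$ for any $x,y\in X$ with $d(x,y)=i$. For a non-empty code $\mathcal{C}\subseteq X$ and $x\in X$, $\delta_x(\mathcal{C}):=|\mathcal{C}|^{-1}\sum_{y\in\mathcal{C}}d(x,y)$.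 For a non-empty family $\mathcal{F}$ of codes, $\overline{\delta_x}(\mathcal{F}):=|\mathcal{F}|^{-1}\sum_{\mathcal{C}\in\mathcal{F}}\delta_x(\mathcal{C})$. *)

(* Defs.v *)
From HB Require Import structures.
From mathcomp Require Import all_boot all_order all_algebra all_field.

Set Implicit Arguments.
Unset Strict Implicit.
Unset Printing Implicit Defensive.

Import GRing.Theory.
Local Open Scope ring_scope.

(* MathComp only provides a choiceType on {vspace X}; over a finite field the
   set of subspaces is finite. *)
HB.instance Definition _ (F : finFieldType) (X : vectType F) :=
  isCountable.Build {vspace X}
    (pcan_pickleK (can_pcan (@VectorInternalTheory.vs2mxK F X))).
HB.instance Definition _ (F : finFieldType) (X : vectType F) :=
  isFinite.Build {vspace X}
    (pcan_enumP (can_pcan (@VectorInternalTheory.vs2mxK F X))).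

Section DistanceRegularSpaces.

Variables (F : finFieldType) (X : vectType F).

(* finvect_type X is X itself, equipped with its finType structure. *)
Local Notation fX := (finvect_type X).

Implicit Types (d : X -> X -> nat) (x y z : X) (C : {set fX}).

Record is_distance d : Prop := IsDistance {
  dist_eq0 : forall x y, d x y = 0%N <-> x = y;
  dist_sym : forall x y, d x y = d y x;
  dist_triangle : forall x y z, (d x z <= d x y + d y z)%N
}.

Definition weight d x : nat := d x 0.

Definition max_weight d : nat := \max_(x : fX) weight d x.

Definition sphere_meet d (x y : X) (j k : nat) : {set fX} :=
  [set z : fX | (d z x == j) && (d z y == k)].

(* The ground field has #|F| = Q elements, which is automatically a prime
   power. *)
Record distance_regular_space d : Prop := DistanceRegularSpace {
  drs_distance : is_distance d;
  drs_scale : forall (a : F) x y, a != 0 -> d (a *: x) (a *: y) = d x y;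
  drs_translation : forall x y, d x y = d 0 (x - y);
  drs_regular : forall x y x' y' (j k : nat), d x y = d x' y' ->
    #|sphere_meet d x y j k| = #|sphere_meet d x' y' j k|;
  (* undup (codom _) lists the image without repetition: |w| = |w(X)| - 1 *)
  drs_weights :
    (max_weight d).+1 = size (undup (codom (fun x : fX => weight d x)))
}.

(* p(i; j, k), computed on an arbitrary pair at distance i; the value is set
   to 0 when no pair is at distance i. *)
Definition intersection_number d (i j k : nat) : nat :=
  if [pick xy : fX * fX | d xy.1 xy.2 == i] is Some xy
  then #|sphere_meet d xy.1 xy.2 j k| else 0%N.

Definition code_avg_dist d x C : rat :=
  (#|C|%:R)^-1 * \sum_(y in C) (d x y)%:R.

Definition family_avg_dist d x (Fam : {set {set fX}}) : rat :=
  (#|Fam|%:R)^-1 * \sum_(C in Fam) code_avg_dist d x C.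

Definition linear_codes (k : nat) : {set {set fX}} :=
  [set [set x : fX | (x : X) \in U] | U : {vspace X} & \dim U == k].

End DistanceRegularSpaces.

(* Main.v *)
(* Every code contains 0, and the general linear group acts transitively on the
   nonzero vectors, so all of them lie in the same number c of codes of
   dimension k. Counting incidences between nonzero vectors and the n codes
   gives c (Q^N - 1) = n (Q^k - 1). Hence the sum of d(x, y) over all codes C
   and all y in C is n w(x) + c (S - w(x)), where S is the sum of all weights,
   by translation invariance; and S is the sum of the i p(0; i, i), since
   p(0; i, i) counts the vectors of weight i. *)
Require Import Defs.
From mathcomp Require Import all_boot all_order all_algebra all_field.
From mathcomp Require Import ring.

Set Implicit Arguments.
Unset Strict Implicit.
Unset Printing Implicit Defensive.

Import GRing.Theory Num.Theory VectorInternalTheory.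
Local Open Scope ring_scope.

(** A nonzero row has [pinvmx u] as right inverse, so [pinvmx u *m v] sends [u] to [v]. It has rank
    one, but preserves the rank of [u], so [complete_unitmx] gives an invertible matrix acting on
    [u] in the same way. *)
Lemma rV_unitmx_transitive (F : fieldType) (n : nat) (u v : 'rV[F]_n) :
  u != 0 -> v != 0 -> exists2 g : 'M_n, g \in unitmx & u *m g = v.
Proof.
move=> u0 v0; have fu : row_free u by rewrite /row_free rank_rV u0.
have uv : u *m (pinvmx u *m v) = v by rewrite mulmxA mulmxVp // mul1mx.
have rk : \rank (u *m (pinvmx u *m v)) = \rank u by rewrite uv !rank_rV u0 v0.
by have [g gU ug] := complete_unitmx rk; exists g; rewrite // -ug uv.
Qed.

Lemma lfun_transitive (F : fieldType) (X : vectType F) (y z : X) :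
  y != 0 -> z != 0 -> exists2 f : 'End(X), lker f == 0%VS & f y = z.
Proof.
move=> y0 z0; have v2r_neq0 (t : X) : t != 0 -> v2r t != 0.
  by apply: contraNneq => t0; rewrite -(v2rK t) t0 linear0.
have [g gU yg] := rV_unitmx_transitive (v2r_neq0 y y0) (v2r_neq0 z z0).
exists (linfun (r2v \o mulmxr g \o v2r)); last by rewrite lfunE /= yg v2rK.
apply/lker0P => s t; rewrite !lfunE /=.
move=> /r2v_inj /(congr1 (mulmx^~ (invmx g))) /=.
by rewrite !mulmxK // => /v2r_inj.
Qed.

Lemma exists_vspace_dim (F : fieldType) (X : vectType F) (k : nat) :
  (k <= \dim {:X})%N -> exists U : {vspace X}, \dim U = k.
Proof.
move=> hk; have /basis_free := vbasisP {:X}.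
rewrite -(cat_take_drop k (vbasis {:X})) => /catl_free /eqP dimU.
by exists <<take k (vbasis {:X})>>%VS; rewrite dimU size_takel // size_tuple.
Qed.

(* Records have no definitional eta: X must be destructed before it unifies
   with the vector space structure of finvect_type X in card_vspace. *)
Lemma card_vspace_finvect (F : finFieldType) (X : vectType F) (U : {vspace X}) :
  #|[set x : finvect_type X | (x : X) \in U]| = (#|F| ^ \dim U)%N.
Proof.
case: X U => T c U; rewrite -(@card_vspace F (finvect_type (Vector.Pack c)) c U).
by apply: eq_card => y; rewrite inE.
Qed.

Section CodesThroughVector.

Variables (F : finFieldType) (X : vectType F) (k : nat).
Local Notation fX := (finvect_type X).

Definition vspaces_through (y : X) : {set {vspace X}} :=
  [set U : {vspace X} | (\dim U == k) && (y \in U)].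

(** An automorphism taking [y] to [z] acts injectively on subspaces and preserves dimension.
    Exchanging [y] and [z] then yields equality. *)
Lemma leq_card_vspaces_through (y z : X) : y != 0 -> z != 0 ->
  (#|vspaces_through y| <= #|vspaces_through z|)%N.
Proof.
move=> y0 z0; have [f f0 fyz] := lfun_transitive y0 z0.
have img_inj : injective (fun U : {vspace X} => (f @: U)%VS).
  by move=> U V /eqP; rewrite eq_limg_ker0 // => /eqP.
rewrite -(card_imset _ img_inj); apply/subset_leq_card/subsetP => _ /imsetP[U + ->].
rewrite !inE => /andP[/eqP dimU yU]; rewrite -fyz memv_img // andbT.
by rewrite limg_dim_eq ?dimU // (eqP f0) capv0.
Qed.

Lemma card_vspaces_through (y z : X) : y != 0 -> z != 0 ->
  #|vspaces_through y| = #|vspaces_through z|.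
Proof. by move=> y0 z0; apply/eqP; rewrite eqn_leq !leq_card_vspaces_through. Qed.

Definition vspace_set (U : {vspace X}) : {set fX} := [set x : fX | (x : X) \in U].

Lemma vspace_set_inj : injective vspace_set.
Proof. by move=> U V /setP eqUV; apply/vspaceP => x; have := eqUV x; rewrite !inE. Qed.

Lemma card_vspace_set (U : {vspace X}) : #|vspace_set U| = (#|F| ^ \dim U)%N.
Proof. exact: card_vspace_finvect. Qed.

Lemma big_linear_codes (R : nmodType) (G : {set fX} -> R) :
  \sum_(C in linear_codes X k) G C = \sum_(U : {vspace X} | \dim U == k) G (vspace_set U).
Proof.
rewrite big_imset /=; last by move=> U V _ _; apply: vspace_set_inj.
by apply: eq_bigl => U; rewrite inE.
Qed.

Lemma card_linear_codes : #|linear_codes X k| = #|[set U : {vspace X} | \dim U == k]|.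
Proof. by rewrite card_imset ?cardsE //; apply: vspace_set_inj. Qed.

(** Double counting, for arbitrary [f] because two instances are needed: the constant 1 for the
    incidence count, and the distance to [x]. *)
Lemma sum_linear_codes (R : nmodType) (f : X -> R) (e : X) : e != 0 ->
  \sum_(C in linear_codes X k) \sum_(y in C) f y =
    f 0 *+ #|linear_codes X k|
    + (\sum_(y : fX | (y : X) != 0) f y) *+ #|vspaces_through e|.
Proof.
move=> e0; rewrite big_linear_codes.
under eq_bigr => U _.
  rewrite (bigD1 (0 : fX)) /=; last by rewrite inE mem0v.
  over.
rewrite big_split /= sumr_const card_linear_codes cardsE; congr (_ + _).
(* After the exchange, each nonzero [y] contributes [f y] once per code containing it. *)
rewrite (exchange_big_dep (fun y : fX => (y : X) != 0)) /=; last first.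
  by move=> U y _ /andP[].
rewrite -sumrMnl; apply: eq_bigr => y y0.
rewrite sumr_const -(card_vspaces_through y0 e0); congr (_ *+ _).
by apply: eq_card => U; rewrite unfold_in /= !inE y0 andbT.
Qed.

End CodesThroughVector.

Section DistanceRegular.

Variables (F : finFieldType) (X : vectType F) (d : X -> X -> nat).
Local Notation fX := (finvect_type X).

(** The default value of [intersection_number] is excluded by the pair [(0, 0)]; regularity replaces
    whichever pair was picked by this one, where both sphere conditions coincide. *)
Lemma intersection_number0 (hd : distance_regular_space d) (i : nat) :
  intersection_number d 0 i i = #|[set z : fX | weight d z == i]|.
Proof.
have d0 (y : X) : d y y = 0%N by apply/(dist_eq0 (drs_distance hd)).
rewrite /intersection_number; case: pickP => [[a b] /= /eqP dab | /(_ (0, 0))]; last first.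
  by rewrite /= d0 eqxx.
have /(drs_regular hd) -> : d a b = d 0 0 by rewrite dab d0.
by apply: eq_card => z; rewrite !inE andbb.
Qed.

Lemma sum_weight (hd : distance_regular_space d) :
  (\sum_(z : fX) weight d z =
   \sum_(0 <= i < (max_weight d).+1) i * intersection_number d 0 i i)%N.
Proof.
rewrite big_mkord.
have le_weight (z : fX) : (weight d z < (max_weight d).+1)%N.
  by rewrite ltnS /max_weight (leq_bigmax z).
rewrite (partition_big (fun z : fX => Ordinal (le_weight z)) xpredT) //=.
apply: eq_bigr => i _; rewrite (intersection_number0 hd) mulnC -sum_nat_const.
apply: eq_big => z; first by rewrite inE -val_eqE.
by move=> /eqP <-.
Qed.

Lemma sum_dist (hd : distance_regular_space d) (x : X) :
  (\sum_(y : fX) d x y = \sum_(z : fX) weight d z)%N.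
Proof.
(* The involution sending [z] to [x - z] turns [d x (x - z)] into [d 0 z]. *)
rewrite (reindex_inj (inv_inj (subKr (x : fX)))) /=; apply: eq_bigr => z _.
by rewrite (drs_translation hd) opprB addrC subrK (dist_sym (drs_distance hd)).
Qed.

End DistanceRegular.

Theorem theorem9p7 (F : finFieldType) (Q : nat) (hQ : #|F| = Q)
  (X : vectType F) (N : nat) (hN : \dim {:X} = N) (hN2 : (2 <= N)%N)
  (d : X -> X -> nat) (hd : distance_regular_space d)
  (k : nat) (hk : (k <= N)%N) (x : X) :
  family_avg_dist d x (linear_codes X k) =
    (weight d x)%:R / Q%:R ^+ k
    + (Q%:R ^+ k - 1) / (Q%:R ^+ k * (Q%:R ^+ N - 1))
      * (- (weight d x)%:R
         + \sum_(0 <= i < (max_weight d).+1)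
             i%:R * (intersection_number d 0 i i)%:R).
Proof.
have X0 : (0 < \dim {:X})%N by rewrite hN ltnW.
pose e := vpick {:X}; have e0 : e != 0 by rewrite vpick0 -dimv_eq0 -lt0n.
pose n := #|linear_codes X k|; pose c := #|vspaces_through k e|.
have cardX : #|finvect_type X| = (Q ^ N)%N.
  by rewrite -hQ -hN -card_vspace_finvect; apply: eq_card => y; rewrite !inE memvf.
have card_code C : C \in linear_codes X k -> #|C| = (Q ^ k)%N.
  by case/imsetP => U; rewrite inE => /eqP <- ->; rewrite card_vspace_set hQ.
have Q1 : (1 < Q)%N by rewrite -hQ finNzRing_gt1.
have n0 : n%:R != 0 :> rat.
  rewrite pnatr_eq0 /n card_linear_codes -lt0n card_gt0.
  have [|U dimU] := @exists_vspace_dim F X k; first by rewrite hN.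
  by apply/set0Pn; exists U; rewrite inE dimU.
have QN1 : Q%:R ^+ N - 1 != 0 :> rat.
  by rewrite subr_eq0 -natrX pnatr_eq1 -(expn0 Q) eqn_exp2l // -lt0n -hN.
have Qk0 : Q%:R ^+ k != 0 :> rat by rewrite -natrX pnatr_eq0 -lt0n expn_gt0 ltnW.
(* Pairs of a code and one of its vectors; the lone [n] accounts for the zero vector. *)
have incidences : n%:R * Q%:R ^+ k = n%:R + c%:R * (Q%:R ^+ N - 1) :> rat.
  have := sum_linear_codes k (fun=> 1 : rat) e0.
  have -> : \sum_(y : finvect_type X | (y : X) != 0) 1 = Q%:R ^+ N - 1 :> rat.
    rewrite -natrX -cardX -sum1_card natr_sum.
    by rewrite [in RHS](bigD1 (0 : finvect_type X)) //= addrAC subrr add0r.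
  under eq_bigr => C hC do rewrite sumr_const card_code //.
  by rewrite sumr_const -/n -/c natrX !mulr_natl.
have dist_sum : \sum_(y : finvect_type X | (y : X) != 0) (d x y)%:R =
    - (weight d x)%:R + \sum_(0 <= i < (max_weight d).+1)
             i%:R * (intersection_number d 0 i i)%:R :> rat.
  under [in RHS]eq_bigr do rewrite -natrM.
  (* The sum of all weights becomes the sum of all distances to [x], whose term at 0 is
     [weight d x]. *)
  rewrite -[in RHS]natr_sum -sum_weight // -(sum_dist hd x) natr_sum.
  by rewrite [in RHS](bigD1 (0 : finvect_type X)) //= addKr.
rewrite /family_avg_dist -/n -dist_sum /code_avg_dist.
(* All codes have size [Q ^ k], so the normalising factor leaves the sum. *)
under eq_bigr => C hC do rewrite card_code // natrX.
rewrite -mulr_sumr (sum_linear_codes k (fun y => (d x y)%:R) e0) -/n -/c.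
(* With [c] proportional to [n], the unknown [n] cancels from the average. *)
have cE : c%:R = n%:R * (Q%:R ^+ k - 1) / (Q%:R ^+ N - 1) :> rat.
  by apply: (canRL (mulfK QN1)); rewrite [RHS]mulrBr incidences mulr1 addrAC subrr add0r.
rewrite -[X in X + _]mulr_natr -[X in _ + X]mulr_natr cE.
by field; rewrite n0 QN1 Qk0.
Qed.
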